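(* Let $X$ be a real Banach space and let $f:[a,b]\to X$. If $md(f,\cdot)$ is continuous at $x\in[a,b]$, and $x$ is a bilaterally metrically regular point of $f$, then $f$ is metrically differentiable at $x$.
   Context: For $f:[a,b]\to X$, the unilateral metric derivatives are $md_{\pm}(f,x)=\lim_{t\to0+}\frac{\|f(x\pm t)-f(x)\|}{t}$. If both exist and are equal (and finite), their common value is the metric derivative $md(f,x)$; at an endpoint of $[a,b]$ only the one-sided limit taken inside $[a,b]$ is used. ''$md(f,\cdot)$ is continuous at $x$'' means that $md(f,s)$ exists for all $s\in[a,b]$ in some neighbourhood of $x$ and $md(f,s)\to md(f,x)$ as $s\to x$, $s\in[a,b]$. The mapping $f$ is metrically differentiable at $x$ if $md(f,x)$ exists and $\|f(y)-f(z)\|-md(f,x)|y-z|=o(|y-x|+|z-x|)$ as $(y,z)\to(x,x)$ with $y,z\in[a,b]$. $\bigvee_y^z f$ denotes the total variation of $f$ on $[y,z]$. A point $x\in[a,b]$ is a bilaterally metrically regular point of $f$ if $\frac{\|f(y)-f(z)\|}{\bigvee_y^z f}\to1$ as $(y,z)\to(x,x)$ with $a\le y\le x\le z\le b$, $(y,z)\ne(x,x)$ (in particular the denominator is nonzero for all such $(y,z)$ close to $(x,x)$). *)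

(* Defs.v *)
From HB Require Import structures.
From mathcomp Require Import all_boot all_order all_algebra.
From mathcomp Require Import all_classical all_reals all_analysis.

Set Implicit Arguments.
Unset Strict Implicit.
Unset Printing Implicit Defensive.

Import Order.TTheory GRing.Theory Num.Theory.
Import numFieldNormedType.Exports.

Local Open Scope classical_set_scope.
Local Open Scope ring_scope.

(* A map [a, b] -> X is represented by f : R -> X; every notion below depends
   only on the values of f on [a, b], for points of [a, b]. *)

Definition is_mdr {R : realType} {X : normedModType R} (f : R -> X) (x l : R) :=
  `|f (x + t) - f x| / t @[t --> 0^'+] --> l.

Definition is_mdl {R : realType} {X : normedModType R} (f : R -> X) (x l : R) :=
  `|f (x - t) - f x| / t @[t --> 0^'+] --> l.

(* "md(f, x) exists and equals l". The guards drop the limit that would leave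
   [a, b] at an endpoint. *)
Definition is_md {R : realType} {X : normedModType R} (a b : R) (f : R -> X)
    (x l : R) :=
  (x < b -> is_mdr f x l) /\ (a < x -> is_mdl f x l).

Definition ex_md {R : realType} {X : normedModType R} (a b : R) (f : R -> X)
    (x : R) :=
  exists l, is_md a b f x l.

(* Unspecified when the metric derivative does not exist. *)
Definition md {R : realType} {X : normedModType R} (a b : R) (f : R -> X)
    (x : R) : R :=
  get (is_md a b f x).

Lemma is_md_md {R : realType} {X : normedModType R} (a b : R) (f : R -> X)
    (x l : R) :
  a < b -> x \in `[a, b] -> is_md a b f x l -> md a b f x = l.
Proof.
move=> ab xab xl.
have [mr ml] : is_md a b f x (md a b f x) by exact: (@getI _ _ l).
case: xl => lr ll.
have [xb|bx] := ltP x b.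
  exact: (cvg_unique _ (mr xb) (lr xb)).
have ax : a < x by exact: lt_le_trans bx.
exact: (cvg_unique _ (ml ax) (ll ax)).
Qed.

Definition md_continuous_at {R : realType} {X : normedModType R} (a b : R)
    (f : R -> X) (x : R) :=
  (\forall s \near x, s \in `[a, b] -> ex_md a b f s) /\
  md a b f s @[s --> within [set` `[a, b]] (nbhs x)] --> md a b f x.

Definition metrically_differentiable {R : realType} {X : normedModType R}
    (a b : R) (f : R -> X) (x : R) :=
  ex_md a b f x /\
  (fun p : R * R => `|f p.1 - f p.2| - md a b f x * `|p.1 - p.2|)
    =o_ (within [set p | p.1 \in `[a, b] /\ p.2 \in `[a, b]] (nbhs (x, x)))
  (fun p : R * R => `|p.1 - x| + `|p.2 - x|).

(* The library's total_variation is restricted to real-valued functions; these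
   are the same definitions for functions with values in a normed space. *)
Definition vvariation {R : realType} {X : normedModType R} (f : R -> X)
    (y : R) (s : seq R) : R :=
  let F := f \o nth y (y :: s) in
  \sum_(0 <= n < size s) `|F n.+1 - F n|.

Definition vtotal_variation {R : realType} {X : normedModType R} (y z : R)
    (f : R -> X) : \bar R :=
  ereal_sup [set (vvariation f y s)%:E | s in itv_partition y z].

(* The quotient is taken in \bar R, where r / +oo = 0 and 0 / 0 = 0, so
   convergence to 1 forces the variation near x to be nonzero and finite. *)
Definition bilaterally_metrically_regular {R : realType} {X : normedModType R}
    (a b : R) (f : R -> X) (x : R) :=
  ((`|f p.1 - f p.2|)%:E / vtotal_variation p.1 p.2 f)%E
    @[p --> within [set p : R * R | [/\ a <= p.1, p.1 <= x, x <= p.2, p.2 <= b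
                                      & p != (x, x)]] (nbhs (x, x))]
    --> 1%:E.

(* Main.v *)
Require Import Defs.
From mathcomp Require Import all_boot all_order all_algebra.
From mathcomp Require Import all_classical all_reals all_analysis.
From mathcomp Require Import ring lra.
Set Implicit Arguments.
Unset Strict Implicit.

Import Order.TTheory GRing.Theory Num.Theory.
Import numFieldNormedType.Exports.

Local Open Scope classical_set_scope.
Local Open Scope ring_scope.

(** Write m for md(f, x). Continuity of md(f, .) at x and a Cousin covering
    argument cut every short interval [y, z] near x into pieces on which the
    increments of f have norm between (m - e) and (m + e) times their length.
    Hence f is (m + e)-Lipschitz near x and its variation on [y, z] is at least
    (m - e)(z - y). Bilateral regularity transfers this lower bound to
    |f y - f z| when y <= x <= z. When y and z lie on the same side of x, the
    lower bound follows from the triangle inequality through f x, and the loss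
    is absorbed by e (|y - x| + |z - x|). *)

Lemma transitive_local_global (R : realType) (P : R -> R -> Prop) (y z : R) :
  y <= z -> (forall s, P s s) ->
  (forall u v w, P u v -> P v w -> P u w) ->
  (forall s, y <= s -> s < z -> \forall t \near 0^'+, P s (s + t)) ->
  (forall s, y < s -> s <= z -> \forall t \near 0^'+, P (s - t) s) ->
  P y z.
Proof.
move=> yz Pxx Ptr Pr Pl.
pose S := [set t | y <= t <= z /\ P y t].
have Sy : S y by split; rewrite ?lexx.
have Subz : ubound S z by move=> t [/andP[]].
have Ssup : has_sup S by split; [exists y | exists z].
have yc : y <= sup S by apply: ub_le_sup => //; exists z.
have cz : sup S <= z by apply: ge_sup => //; exists y.
have Pyc : P y (sup S).
  move: yc; rewrite le_eqVlt => /predU1P[<- //|yc].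
  have [d /= d0 Hd] := Pl _ yc cz.
  have [t [tz Pyt] ct] := sup_adherent d0 Ssup.
  have : t <= sup S by apply: ub_le_sup => //; exists z.
  rewrite le_eqVlt => /predU1P[<- //|tc].
  apply: (Ptr _ _ _ Pyt); rewrite -[t](subKr (sup S)).
  apply: Hd; last by rewrite /= subr_gt0.
  by rewrite /= sub0r normrN ger0_norm ?subr_ge0 ?ltW//; lra.
move: cz; rewrite le_eqVlt => /predU1P[<- //|cz].
have zc0 : 0 < z - sup S by rewrite subr_gt0.
have [t [t0 [tz Pct]]] :
    exists t, 0 < t /\ (t < z - sup S /\ P (sup S) (sup S + t)).
  apply: (@filter_ex _ (0^'+)); apply: filterI; first exact: nbhs_right_gt.
  by apply: filterI; [exact: nbhs_right_lt | exact: Pr].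
have : sup S + t <= sup S.
  apply: ub_le_sup; first by exists z.
  by split; [lra | exact: Ptr Pct].
lra.
Qed.

Section Variation.
Context {R : realType} {X : normedModType R}.
Implicit Types (f : R -> X) (y z u v : R).

Lemma vvariation_nil f y : vvariation f y [::] = 0.
Proof. by rewrite /vvariation big_nil. Qed.

Lemma vvariation_cons f y z s :
  vvariation f y (z :: s) = `|f z - f y| + vvariation f z s.
Proof.
rewrite /vvariation /= big_nat_recl//=; congr (_ + _).
rewrite !big_nat; apply: eq_bigr => i /andP[_ si].
rewrite (@set_nth_default _ _ z y)//; congr (`|_ - f _|).
by apply: set_nth_default; rewrite /= ltnS ltnW.
Qed.

Lemma vvariation_cat f y s t :
  vvariation f y (s ++ t) = vvariation f y s + vvariation f (last y s) t.
Proof.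
elim: s y => [|z s IH] y /=; first by rewrite vvariation_nil add0r.
by rewrite !vvariation_cons IH addrA.
Qed.

Lemma dist_le_vvariation f y s : `|f (last y s) - f y| <= vvariation f y s.
Proof.
elim: s y => [|z s IH] y /=; first by rewrite subrr normr0 vvariation_nil.
rewrite vvariation_cons.
rewrite (_ : _ - f y = (f z - f y) + (f (last z s) - f z)).
  by rewrite (le_trans (ler_normD _ _))// lerD2l.
by rewrite [RHS]addrC subrKA.
Qed.

Lemma vvariation_le_lipschitz f (L : R) y s :
  path <%R y s ->
  (forall u v, y <= u -> u <= v -> v <= last y s ->
    `|f v - f u| <= L * (v - u)) ->
  vvariation f y s <= L * (last y s - y).
Proof.
elim: s y => [|z s IH] y /=; first by rewrite vvariation_nil subrr mulr0.
move=> /andP[yz zs] lip; rewrite vvariation_cons.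
have zl : z <= last z s by apply: (itv_partition_le (conj zs (eqxx _))).
have IHz : vvariation f z s <= L * (last z s - z).
  by apply: IH => // u v zu; apply: lip; exact: le_trans (ltW yz) zu.
have := lip _ _ (lexx y) (ltW yz) zl.
lra.
Qed.

Lemma vtotal_variation_le_lipschitz f (L : R) y z :
  (forall u v, y <= u -> u <= v -> v <= z -> `|f v - f u| <= L * (v - u)) ->
  (vtotal_variation y z f <= (L * (z - y))%:E)%E.
Proof.
move=> lip; apply: ge_ereal_sup => _ [s [ys /eqP sz] <-].
by rewrite lee_fin -sz; apply: vvariation_le_lipschitz; rewrite ?sz.
Qed.

Lemma slope_near (g t l m e : R) : 0 < t -> `|g / t - l| < e - `|l - m| ->
  `|g - m * t| <= e * t.
Proof.
move=> t0 gl; rewrite -[g](divfK (lt0r_neq0 t0)) -mulrBl normrM (gtr0_norm t0).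
rewrite ler_wpM2r ?(ltW t0)//.
have := ler_distD l (g / t) m; lra.
Qed.

Lemma vvariation_ge0 f y s : 0 <= vvariation f y s.
Proof. by apply: sumr_ge0. Qed.

(* A partition that is fine in the sense of Cousin's lemma: each of its
   increments is taken at a point where the metric derivative is close to [m]. *)
Lemma exists_partition_near_md (a b : R) f (m e y z : R) :
  a <= y -> y <= z -> z <= b ->
  (forall s, y <= s <= z -> exists2 l, is_md a b f s l & `|l - m| < e) ->
  exists2 s, itv_partition y z s &
    `|vvariation f y s - m * (z - y)| <= e * (z - y).
Proof.
move=> ay yz zb fm.
apply: (@transitive_local_global _ (fun u v => exists2 s, itv_partition u v s &
  `|vvariation f u s - m * (v - u)| <= e * (v - u))) => //.
- move=> s; exists [::]; first by split=> /=.
  by rewrite vvariation_nil !subrr !mulr0 subrr normr0.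
- move=> u v w [s [us /eqP sv] Hs] [t [vt tw] Ht].
  exists (s ++ t).
    by split; [rewrite cat_path us sv | rewrite last_cat sv].
  rewrite vvariation_cat sv.
  rewrite (_ : _ - _ = (vvariation f u s - m * (v - u)) +
     (vvariation f v t - m * (w - v))); last by ring.
  by rewrite (le_trans (ler_normD _ _))//; lra.
- move=> s ys sz.
  have [|l [+ _] lm] := fm s; first by rewrite ys ltW.
  move=> /(_ (lt_le_trans sz zb)) fl.
  have dlm : 0 < e - `|l - m| by rewrite subr_gt0.
  have /(_ _) fnear := cvgr_distC_lt _ _ fl _ dlm.
  apply: filterS (filterI (nbhs_right_gt 0) fnear) => t [t0 tl].
  exists [:: s + t]; first by split=> //=; rewrite ltrDl t0.
  rewrite vvariation_cons vvariation_nil addr0 [s + t - s]addrAC subrr add0r.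
  exact: slope_near t0 tl.
- move=> s ys sz.
  have [|l [_ +] lm] := fm s; first by rewrite sz ltW.
  move=> /(_ (le_lt_trans ay ys)) fl.
  have dlm : 0 < e - `|l - m| by rewrite subr_gt0.
  have /(_ _) fnear := cvgr_distC_lt _ _ fl _ dlm.
  apply: filterS (filterI (nbhs_right_gt 0) fnear) => t [t0 tl].
  exists [:: s]; first by split=> //=; rewrite ltrBlDr ltrDl t0.
  rewrite vvariation_cons vvariation_nil addr0 subKr (distrC (f s)).
  exact: slope_near t0 tl.
Qed.

Lemma md_lipschitz (a b : R) f (m e y z : R) :
  a <= y -> y <= z -> z <= b ->
  (forall s, y <= s <= z -> exists2 l, is_md a b f s l & `|l - m| < e) ->
  `|f z - f y| <= (m + e) * (z - y).
Proof.
move=> ay yz zb /(exists_partition_near_md ay yz zb)[s [_ /eqP sz]].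
rewrite -[in f z]sz; have := dist_le_vvariation f y s.
by rewrite ler_norml => ? /andP[_]; lra.
Qed.

Lemma md_total_variation (a b : R) f (m e y z : R) :
  a <= y -> y <= z -> z <= b ->
  (forall s, y <= s <= z -> exists2 l, is_md a b f s l & `|l - m| < e) ->
  exists v, [/\ vtotal_variation y z f = v%:E, 0 <= v & (m - e) * (z - y) <= v].
Proof.
move=> ay yz zb fm.
have Vle : (vtotal_variation y z f <= ((m + e) * (z - y))%:E)%E.
  apply: vtotal_variation_le_lipschitz => u v yu uv vz.
  apply: md_lipschitz (le_trans ay yu) uv (le_trans vz zb) _.
  by move=> s /andP[us sv]; apply: fm; rewrite (le_trans yu) ?(le_trans sv).
have [s ps] := exists_partition_near_md ay yz zb fm.
rewrite ler_norml => /andP[+ _] => sge.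
have Vge : ((vvariation f y s)%:E <= vtotal_variation y z f)%E.
  by apply: ereal_sup_ubound; exists s.
case: (vtotal_variation y z f) Vle Vge => [v| |]//= _.
rewrite lee_fin => Vge; exists v; split=> //; last lra.
exact: le_trans (vvariation_ge0 _ _ _) Vge.
Qed.

End Variation.

Unset Implicit Arguments.

Theorem lemma5p2 (R : realType) (X : completeNormedModType R) (a b : R)
    (hab : a < b) (f : R -> X) (x : R) (hx : x \in `[a, b])
    (hmd : md_continuous_at a b f x)
    (hreg : bilaterally_metrically_regular a b f x) :
  metrically_differentiable a b f x.
Proof.
have [hex hcont] := hmd.
have exmd s : ex_md a b f s -> is_md a b f s (md a b f s).
  by move=> [l sl]; exact: (@getI _ _ l).
split; first exact: (nbhs_singleton hex hx).
set m := md a b f x in hcont *.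
apply/eqoP => e e0.
pose d := e / 2.
have d0 : 0 < d by rewrite divr_gt0.
(* Chosen so that (1 - h) (m - d) >= m - 2 d = m - e when m >= d. *)
pose h := d / (`|m| + 1).
have m10 : 0 < `|m| + 1 by rewrite ltr_wpDl.
have h0 : 0 < h by rewrite divr_gt0.
have hmE : h * (`|m| + 1) = d by rewrite /h divfK// gt_eqF.
have : nbhs 1%:E [set u | (1 - h)%:E < u]%E.
  apply: open_nbhs_nbhs; split; first exact: open_ereal_gt_ereal.
  by rewrite /= lte_fin; lra.
move=> /hreg[[A B] /= [nA nB] AB].
have /(_ _) nearmd := cvgr_distC_lt _ _ hcont _ d0.
have : \forall s \near x, [/\ A s, B s &
    s \in `[a, b] -> exists2 l, is_md a b f s l & `|l - m| < d].
  have /(_ _) hexmd := filterI hex nearmd.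
  apply: filterS (filterI (filterI nA nB) hexmd) => s [[As Bs] [exs mds]].
  split=> // sab; exists (md a b f s); [exact: exmd (exs sab) | exact: mds].
move=> /nbhs_ballP[r /= r0 xr].
have md_near y z : x - r < y -> z < x + r -> a <= y -> z <= b ->
    forall s, y <= s <= z -> exists2 l, is_md a b f s l & `|l - m| < d.
  move=> ry rz ay zb s /andP[ys sz].
  have [|_ _] := xr s; first by rewrite /ball /= ltr_distlC; apply/andP; lra.
  by apply; rewrite in_itv/=; apply/andP; lra.
have nearAB s : x - r < s < x + r -> A s /\ B s.
  by rewrite -ltr_distlC => /xr[].
have bilateral y z : x - r < y -> z < x + r -> a <= y -> z <= b ->
    y <= x -> x <= z -> `| `|f y - f z| - m * (z - y)| <= e * (z - y).
  move=> ry rz ay zb yx xz.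
  have yz := le_trans yx xz.
  have mdyz := md_near _ _ ry rz ay zb.
  have [[-> ->]|yzx] := eqVneq (y, z) (x, x).
    by rewrite !subrr normr0 !mulr0 subrr normr0.
  have := md_lipschitz ay yz zb mdyz; rewrite distrC => fle.
  have [v [vE v_ge0 vge]] := md_total_variation ay yz zb mdyz.
  have fge : (1 - h) * v <= `|f y - f z|.
    have [|Ay _] := nearAB y; first by apply/andP; lra.
    have [|_ Bz] := nearAB z; first by apply/andP; lra.
    have := AB (y, z) (conj Ay Bz) (And5 ay yx xz zb yzx).
    rewrite /= vE inver; have [-> _|v0] := eqVneq v 0; first by rewrite mulr0.
    have vgt0 : 0 < v by rewrite lt0r v0.
    by rewrite -EFinM lte_fin ltr_pdivlMr// => /ltW.
  have D0 : 0 <= z - y by rewrite subr_ge0.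
  have dD : 0 <= d * (z - y) by rewrite mulr_ge0 // ltW.
  have eE : e * (z - y) = d * (z - y) + d * (z - y) by rewrite /d; field.
  rewrite ler_norml; apply/andP; split; last by lra.
  have [md|dm] := ltP m d.
    have : m * (z - y) <= d * (z - y) by rewrite ler_wpM2r// ltW.
    have := normr_ge0 (f y - f z); lra.
  have mE : `|m| = m by rewrite ger0_norm// (le_trans (ltW d0)).
  rewrite mE in hmE m10.
  have h1 : 0 <= 1 - h.
    rewrite subr_ge0 -(ler_pM2r m10) hmE; lra.
  have := ler_wpM2l h1 vge.
  have : 0 <= h * (1 + d) * (z - y) by rewrite !mulr_ge0// ?ltW//; lra.
  have -> : (1 - h) * ((m - d) * (z - y)) =
    (m - d - h * (m + 1) + h * (1 + d)) * (z - y) by ring.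
  rewrite hmE; lra.
have estimate y z : x - r < y -> z < x + r -> a <= y -> z <= b -> y <= z ->
    `| `|f y - f z| - m * (z - y)| <= e * (`|y - x| + `|z - x|).
  move=> ry rz ay zb yz.
  have mdyz := md_near _ _ ry rz ay zb.
  have := md_lipschitz ay yz zb mdyz; rewrite distrC => fle.
  have de : d * (z - y) <= e * (z - y).
    by rewrite ler_wpM2r ?subr_ge0// /d; lra.
  have [ax xb] : a <= x /\ x <= b by move: hx; rewrite in_itv/= => /andP.
  have [rx xr0] : x - r < x /\ x < x + r by split; lra.
  have [xy|yx] := leP x y.
    have xz := le_trans xy yz.
    rewrite (ger0_norm (x := y - x)) ?(ger0_norm (x := z - x)) ?subr_ge0//.
    have := bilateral x y rx (le_lt_trans yz rz) ax (le_trans yz zb) (lexx x) xy.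
    have := bilateral x z rx rz ax zb (lexx x) xz.
    rewrite !ler_norml => /andP[? ?] /andP[? ?].
    have := ler_distD (f y) (f x) (f z).
    have : 0 <= e * (y - x) by rewrite mulr_ge0 ?subr_ge0// ltW.
    by move=> *; apply/andP; split; lra.
  have [zx|xz] := leP z x.
    rewrite (ler0_norm (x := y - x)) ?(ler0_norm (x := z - x)) ?subr_le0 ?(ltW yx)//.
    have := bilateral y x ry xr0 ay xb (ltW yx) (lexx x).
    have := bilateral z x (lt_le_trans ry yz) xr0 (le_trans ay yz) xb zx (lexx x).
    rewrite !ler_norml => /andP[? ?] /andP[? ?].
    have := ler_distD (f z) (f y) (f x).
    have : 0 <= e * (x - z) by rewrite mulr_ge0 ?subr_ge0// ltW.
    by move=> *; apply/andP; split; lra.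
  rewrite (ltr0_norm (x := y - x)) ?(gtr0_norm (x := z - x)) ?subr_gt0 ?subr_lt0//.
  have := bilateral y z ry rz ay zb (ltW yx) (ltW xz); lra.
exists (ball x r, ball x r); first by split; exact: nbhsx_ballx.
move=> [y z] [/=]; rewrite /ball /= => yr zr [yab zab].
have [/andP[? ?] /andP[? ?]] : x - r < y < x + r /\ x - r < z < x + r.
  by rewrite -!ltr_distlC.
move: yab zab; rewrite !in_itv/= => /andP[? ?] /andP[? ?].
rewrite (ger0_norm (x := `|y - x| + `|z - x|)) ?addr_ge0//.
have [yz|/ltW zy] := leP y z.
  by rewrite (distrC y z) (ger0_norm (x := z - y)) ?subr_ge0//; exact: estimate.
rewrite (ger0_norm (x := y - z)) ?subr_ge0// (distrC (f y)) [`|y - x| + _]addrC.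
exact: estimate.
Qed.
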